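(* Let $G=(V,E)$ be a finite connected simple graph with vertex set $V=\{a_1,\dots,a_N\}$, $N\ge 2$. For each $\mu=(\mu_i)_{i=1}^N\in\mathcal{M}$ and each subset $B$ of $\mathcal{M}$ that is compact with respect to the Euclidean metric, there exist a potential function $\Psi=(\Psi_i)_{i=1}^N\in\mathbb{R}^N$ on $V$ and a constant $K=K(B,\mu,G)>0$ such that for every $\nu=(\nu_i)_{i=1}^N\in B$, $$d_\Psi^2(\mu,\nu)\le K\,H(\nu\,|\,\mu),$$ where $H(\nu|\mu)=\sum_{i=1}^N\nu_i\log\frac{\nu_i}{\mu_i}$ and $d_\Psi$ is the discrete Wasserstein-type distance on $\mathcal{M}$ associated with $\Psi$ and $G$ (defined in the context).
   Context: $\mathcal{M}=\{\rho=(\rho_i)_{i=1}^N\in\mathbb{R}^N:\ \sum_{i=1}^N\rho_i=1,\ \rho_i>0 \text{ for all } i\}$, with tangent space $T_\rho\mathcal{M}=\{\sigma\in\mathbb{R}^N:\sum_{i=1}^N\sigma_i=0\}$ at each $\rho\in\mathcal{M}$. Given a potential $\Psi\in\mathbb{R}^N$ and $\rho\in\mathcal{M}$, define the symmetric weight matrix $w(\rho)=(w_{ij}(\rho))_{i,j=1}^N$ by $w_{ij}(\rho)=0$ if $\{a_i,a_j\}\notin E$, and, for $\{a_i,a_j\}\in E$: $w_{ij}(\rho)=\rho_i$ if $\Psi_i>\Psi_j$; $w_{ij}(\rho)=\rho_j$ if $\Psi_i<\Psi_j$; $w_{ij}(\rho)=\frac{\rho_i-\rho_j}{\log\rho_i-\log\rho_j}$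 if $\Psi_i=\Psi_j$ (interpreted as $\rho_i$ when $\rho_i=\rho_j$). Let $\mathcal{L}(G,w(\rho))=\mathrm{diag}(\delta_1,\dots,\delta_N)-w(\rho)$, where $\delta_i$ is the $i$th row sum of $w(\rho)$, be the weighted Laplacian matrix. The map $p\mapsto p\,\mathcal{L}(G,w(\rho))$ (row vectors) induces a linear isomorphism from $\mathbb{R}^N/\mathbb{R}(1,\dots,1)$ onto $T_\rho\mathcal{M}$. Define the inner product on $T_\rho\mathcal{M}$ by $$g^\Psi_\rho(\sigma^1,\sigma^2)=p^1\,\mathcal{L}(G,w(\rho))\,(p^2)^T,\quad\text{where } \sigma^k=p^k\mathcal{L}(G,w(\rho)),\ k=1,2.$$ The distance is $$d_\Psi(\rho^1,\rho^2)=\inf_\gamma\int_0^1\sqrt{g^\Psi_{\gamma(t)}(\dot\gamma(t),\dot\gamma(t))}\,dt,$$ the infimum being over all continuously differentiable curves $\gamma:[0,1]\to\mathcal{M}$ with $\gamma(0)=\rho^1$, $\gamma(1)=\rho^2$. *)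

(* Defs.v *)
From HB Require Import structures.
From mathcomp Require Export all_boot all_order all_algebra.
From mathcomp Require Export all_classical all_reals all_analysis.
Export numFieldNormedType.Exports.
Export Order.TTheory GRing.Theory Num.Theory.

Set Implicit Arguments.
Unset Strict Implicit.
Unset Printing Implicit Defensive.

Local Open Scope classical_set_scope.
Local Open Scope ring_scope.

(* A simple graph on the vertices a_0, ..., a_(N-1) is given by its adjacency
   relation. *)
Record connected_simple_graph (N : nat) (e : rel 'I_N) : Prop := {
  graph_irrefl : irreflexive e;
  graph_sym : symmetric e;
  graph_connected : forall i j, connect e i j
}.

Definition simplex_interior (R : realType) (N : nat) : set 'rV[R]_N :=
  [set rho | \sum_(i < N) rho 0 i = 1 /\ forall i, 0 < rho 0 i].

Definition logmean (R : realType) (x y : R) : R :=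
  if x == y then x else (x - y) / (ln x - ln y).

Definition weight (R : realType) (N : nat) (e : rel 'I_N)
    (Psi rho : 'rV[R]_N) : 'M[R]_N :=
  \matrix_(i, j)
    if ~~ e i j then 0
    else if Psi 0 j < Psi 0 i then rho 0 i
    else if Psi 0 i < Psi 0 j then rho 0 j
    else logmean (rho 0 i) (rho 0 j).

Definition laplacian (R : realType) (N : nat) (w : 'M[R]_N) : 'M[R]_N :=
  diag_mx (\row_i \sum_(j < N) w i j) - w.

(* [sigma *m pinvmx L] is some p with [p *m L = sigma], for every sigma in the
   row space of L; by [wmetricE] the value of the metric does not depend on
   which one is taken. *)
Definition wmetric (R : realType) (N : nat) (e : rel 'I_N)
    (Psi rho sigma1 sigma2 : 'rV[R]_N) : R :=
  let L := laplacian (weight e Psi rho) in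
  let p1 := sigma1 *m pinvmx L in
  let p2 := sigma2 *m pinvmx L in
  (p1 *m L *m p2^T) 0 0.

Lemma logmeanC (R : realType) (x y : R) : logmean x y = logmean y x.
Proof.
rewrite /logmean eq_sym; case: eqP => [->//|_].
by rewrite -(opprB y x) -(opprB (ln y)) invrN mulrNN.
Qed.

Lemma weight_sym (R : realType) (N : nat) (e : rel 'I_N) (Psi rho : 'rV[R]_N) :
  symmetric e -> (weight e Psi rho)^T = weight e Psi rho.
Proof.
move=> es; apply/matrixP => i j; rewrite !mxE es; case: (e i j) => //=.
by case: ltgtP => // _; rewrite logmeanC.
Qed.

Lemma wmetricE (R : realType) (N : nat) (e : rel 'I_N)
    (Psi rho p1 p2 : 'rV[R]_N) : symmetric e ->
  let L := laplacian (weight e Psi rho) in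
  wmetric e Psi rho (p1 *m L) (p2 *m L) = (p1 *m L *m p2^T) 0 0.
Proof.
move=> es L; rewrite /wmetric -/L mulmxKpV ?submxMl//.
have LT : L^T = L.
  by rewrite /L /laplacian linearB /= tr_diag_mx weight_sym.
have E (q : 'rV[R]_N) : p1 *m L *m q^T = p1 *m (q *m L)^T.
  by rewrite trmx_mul LT mulmxA.
by rewrite !E mulmxKpV ?submxMl.
Qed.

(* At the endpoints 0 and 1 the derivative is one-sided. *)
Definition C1_on_unit (R : realType) (N : nat) (gamma dgamma : R -> 'rV[R]_N) :=
  (forall t : R, t \in `[0, 1] ->
     (s - t)^-1 *: (gamma s - gamma t) @[s --> within `[0, 1] t^'] --> dgamma t)
  /\ {within `[0, 1], continuous dgamma}.

Definition admissible (R : realType) (N : nat) (rho1 rho2 : 'rV[R]_N)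
    (gamma dgamma : R -> 'rV[R]_N) :=
  [/\ C1_on_unit gamma dgamma,
      forall t : R, t \in `[0, 1] -> simplex_interior (gamma t),
      gamma 0 = rho1 & gamma 1 = rho2].

Definition curve_length (R : realType) (N : nat) (e : rel 'I_N)
    (Psi : 'rV[R]_N) (gamma dgamma : R -> 'rV[R]_N) : \bar R :=
  (\int[lebesgue_measure]_(t in `[0%R, 1%R])
     (Num.sqrt (wmetric e Psi (gamma t) (dgamma t) (dgamma t)))%:E)%E.

(* The infimum is taken in the extended reals, where that of the empty set is
   +oo. *)
Definition wdist (R : realType) (N : nat) (e : rel 'I_N)
    (Psi rho1 rho2 : 'rV[R]_N) : \bar R :=
  ereal_inf [set l | exists gamma dgamma : R -> 'rV[R]_N,
    admissible rho1 rho2 gamma dgamma /\ l = curve_length e Psi gamma dgamma].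

Definition rel_entropy (R : realType) (N : nat) (nu mu : 'rV[R]_N) : R :=
  \sum_(i < N) nu 0 i * ln (nu 0 i / mu 0 i).

(* Main.v *)
(* Take Psi injective, so that every edge weight is one of the two end
   densities, and join mu to nu by a straight segment, along which all densities
   stay above a constant c > 0 given by compactness. For sigma = p L, the energy
   D = p L p^T controls each difference of p along an edge by sqrt (2 D / c),
   hence all differences by connectedness; since sum_i sigma_i = 0,
   D = sum_i sigma_i (p_i - p_0), which turns this into
   D <= (2 N^4 / c) max_i sigma_i^2. Finally (nu_i - mu_i)^2 <= 4 H(nu|mu), so
   the speed of the segment is at most sqrt (K H(nu|mu)) with K = 8 N^4 / c. *)
Require Import Defs.
From mathcomp Require Import ring lra.

Set Implicit Arguments.
Unset Strict Implicit.
Unset Printing Implicit Defensive.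

Local Open Scope classical_set_scope.
Local Open Scope ring_scope.

(** Symmetrization: the energy is the double sum of [w i j * (p i * (p i - p j))], and adding its
    copy with [i] and [j] swapped completes the square. *)
Lemma laplacian_dirichlet (R : realType) (N : nat) (w : 'M[R]_N)
    (p : 'rV[R]_N) : w^T = w ->
  2 * (p *m laplacian w *m p^T) 0 0
    = \sum_i \sum_j w i j * (p 0 i - p 0 j) ^+ 2.
Proof.
move=> wT; have wC i j : w i j = w j i by rewrite -{1}wT mxE.
have -> : (p *m laplacian w *m p^T) 0 0
    = \sum_i \sum_j w i j * (p 0 i * (p 0 i - p 0 j)).
  rewrite mxE; apply: eq_bigr => i _.
  rewrite mulmxBr mul_mx_diag !mxE mulrBl mulrAC mulr_sumr mulr_suml -sumrB.
  by apply: eq_bigr => j _; rewrite (wC j i); ring.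
rewrite mulr2n mulrDl mul1r [X in _ + X = _]exchange_big -big_split /=.
apply: eq_bigr => i _; rewrite -big_split /=; apply: eq_bigr => j _.
by rewrite (wC j i); ring.
Qed.

Lemma path_dist_le (R : realDomainType) (T : eqType) (e : rel T)
    (f : T -> R) (S : R) (x : T) (s : seq T) :
  (forall y z, e y z -> `|f y - f z| <= S) ->
  path e x s -> `|f x - f (last x s)| <= (size s)%:R * S.
Proof.
move=> fS; elim: s x => [|y s IH] x /=; first by rewrite subrr normr0 mul0r.
move=> /andP[/fS xy /IH ys]; rewrite -natr1 mulrDl mul1r [leRHS]addrC.
by rewrite (le_trans (ler_distD (f y) _ _))// lerD.
Qed.

Lemma connected_dist_le (R : realDomainType) (N : nat) (e : rel 'I_N)
    (f : 'I_N -> R) (S : R) (i j : 'I_N) :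
  0 <= S -> (forall i j, e i j -> `|f i - f j| <= S) ->
  connect e i j -> `|f i - f j| <= N%:R * S.
Proof.
(* A duplicate-free path visits at most [N] vertices, so it has fewer than [N] edges. *)
move=> S0 fS /connectP[s0 ps0 ->]; case/shortenP: ps0 => s ps us _.
apply: le_trans (path_dist_le fS ps) _.
rewrite ler_wpM2r// ler_nat ltnW//.
by have := max_card (mem (i :: s)); rewrite card_ord (card_uniqP us).
Qed.

(* This is [ln u <= u - 1] at [u = sqrt (m / x)]. *)
Lemma xlnx_ge_sqr_sqrtB (R : realType) (x m : R) : 0 < x -> 0 < m ->
  (Num.sqrt x - Num.sqrt m) ^+ 2 <= x * ln (x / m) - x + m.
Proof.
move=> x0 m0; set a := Num.sqrt x; set b := Num.sqrt m.
have a0 : 0 < a by rewrite sqrtr_gt0.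
have b0 : 0 < b by rewrite sqrtr_gt0.
have xE : x = a ^+ 2 by rewrite sqr_sqrtr// ltW.
have mE : m = b ^+ 2 by rewrite sqr_sqrtr// ltW.
have ba0 : 0 < b / a by rewrite divr_gt0.
have L : ln (b / a) <= b / a - 1.
  by have := @le_ln1Dx R (b / a - 1); rewrite addrCA subrr addr0; apply; lra.
have -> : x / m = (b / a)^-1 ^+ 2 by rewrite xE mE -expr_div_n invf_div.
rewrite lnXn ?invr_gt0// lnV ?posrE// xE mE.
have : a ^+ 2 * ln (b / a) <= a ^+ 2 * (b / a - 1).
  by rewrite ler_wpM2l// sqr_ge0.
have -> : a ^+ 2 * (b / a - 1) = a * b - a ^+ 2 by field; rewrite gt_eqF.
rewrite mulr2n; nra.
Qed.

(** Since both densities sum to 1, adding [- nu_j + mu_j] to each summand leaves the entropy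
    unchanged and makes every summand nonnegative; the [i]-th one alone then gives the bound. *)
Lemma rel_entropy_ge (R : realType) (N : nat) (nu mu : 'rV[R]_N) (i : 'I_N) :
  simplex_interior nu -> simplex_interior mu ->
  (nu 0 i - mu 0 i) ^+ 2 <= 4 * rel_entropy nu mu.
Proof.
move=> [nu1 nu0] [mu1 mu0].
have le1 (rho : 'rV[R]_N) j : \sum_i rho 0 i = 1 ->
    (forall i, 0 < rho 0 i) -> rho 0 j <= 1.
  move=> <- rho0; rewrite (bigD1 j)//= lerDl.
  by apply: sumr_ge0 => k _; exact: ltW.
have -> : rel_entropy nu mu
    = \sum_j (nu 0 j * ln (nu 0 j / mu 0 j) - nu 0 j + mu 0 j).
  by rewrite big_split/= sumrB nu1 mu1 subrK.
rewrite (bigD1 i)//=; set s := \sum_(j | _) _.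
have s0 : 0 <= s.
  by apply: sumr_ge0 => j _; rewrite (le_trans _ (xlnx_ge_sqr_sqrtB _ _))// sqr_ge0.
have := xlnx_ge_sqr_sqrtB (nu0 i) (mu0 i).
set t := _ + mu 0 i.
have : Num.sqrt (nu 0 i) <= 1 by rewrite -sqrtr1 ler_sqrt// le1.
have : Num.sqrt (mu 0 i) <= 1 by rewrite -sqrtr1 ler_sqrt// le1.
have := sqrtr_ge0 (nu 0 i); have := sqrtr_ge0 (mu 0 i).
have := sqr_sqrtr (ltW (nu0 i)); have := sqr_sqrtr (ltW (mu0 i)).
move: (Num.sqrt _) (Num.sqrt _) => b a muE nuE b0 a0 b1 a1 tge.
(* The 4 bounds the square of [a + b], both roots being at most 1. *)
rewrite -muE -nuE subr_sqr exprMn.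
apply: (@le_trans _ _ (4 * (b - a) ^+ 2)); last by lra.
by rewrite [leRHS]mulrC ler_wpM2l ?sqr_ge0//; nra.
Qed.

Lemma laplacian_dist_le (R : realType) (N : nat) (e : rel 'I_N)
    (w : 'M[R]_N) (c : R) (p : 'rV[R]_N) (i j : 'I_N) :
  (forall i j, connect e i j) -> w^T = w -> (forall i j, 0 <= w i j) ->
  0 < c -> (forall i j, e i j -> c <= w i j) ->
  `|p 0 i - p 0 j|
    <= N%:R * Num.sqrt (2 * (p *m laplacian w *m p^T) 0 0 / c).
Proof.
move=> ce wT w0 c0 cw; apply: (@connected_dist_le _ _ e (p 0)) => // [k l ekl].
rewrite -sqrtr_sqr ler_sqrt ?ler_pdivlMr// laplacian_dirichlet//.
  (* Only the [(k, l)] term of the nonnegative double sum is kept. *)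
  rewrite (bigD1 k)//= (bigD1 l)//= -addrA mulrC.
  have h0 x y : 0 <= w x y * (p 0 x - p 0 y) ^+ 2 by rewrite mulr_ge0// sqr_ge0.
  rewrite -[leLHS]addr0 lerD ?ler_wpM2r ?sqr_ge0 ?cw//.
  by rewrite addr_ge0//; do ?[apply: sumr_ge0 => ? _].
rewrite mul0r; do 2![apply: sumr_ge0 => ? _].
by rewrite mulr_ge0 ?sqr_ge0.
Qed.

(* The columns of the cokernel of L have zero energy, hence are constant. *)
Lemma sub_laplacian (R : realType) (N : nat) (e : rel 'I_N)
    (w : 'M[R]_N) (c : R) (sigma : 'rV[R]_N) :
  (forall i j, connect e i j) -> w^T = w -> (forall i j, 0 <= w i j) ->
  0 < c -> (forall i j, e i j -> c <= w i j) ->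
  \sum_i sigma 0 i = 0 -> (sigma <= laplacian w)%MS.
Proof.
move=> ce wT w0 c0 cw s0.
have LT : (laplacian w)^T = laplacian w.
  by rewrite /laplacian linearB /= tr_diag_mx wT.
rewrite submxE; apply/eqP/rowP => k; rewrite !mxE.
set C := cokermx _.
have C0 : (col k C)^T *m laplacian w = 0.
  by rewrite -LT -trmx_mul colE mulmxA mulmx_coker mul0mx; apply/rowP => i; rewrite !mxE.
have Cc i j : C i k = C j k.
  have := laplacian_dist_le (col k C)^T i j ce wT w0 c0 cw.
  by rewrite C0 mul0mx !mxE mulr0 mul0r sqrtr0 mulr0 normr_le0 subr_eq0 => /eqP.
transitivity (\sum_i sigma 0 i * C k k); last by rewrite -mulr_suml s0 mul0r.
by apply: eq_bigr => i _; rewrite (Cc i k).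
Qed.

Lemma laplacian_energy_le (R : realType) (N : nat) (e : rel 'I_N)
    (w : 'M[R]_N) (c h : R) (p : 'rV[R]_N) :
  (forall i j, connect e i j) -> w^T = w -> (forall i j, 0 <= w i j) ->
  0 < c -> (forall i j, e i j -> c <= w i j) ->
  \sum_i (p *m laplacian w) 0 i = 0 ->
  (forall i, (p *m laplacian w) 0 i ^+ 2 <= h) ->
  (p *m laplacian w *m p^T) 0 0 <= 2 * N%:R ^+ 4 / c * h.
Proof.
move=> ce wT w0 c0 cw s0 sh.
(* The argument uses vertex 0 as base point, so the empty graph is treated apart. *)
case: N => [|N] in e w p ce wT w0 cw s0 sh *.
  by rewrite mxE big_ord0 expr0n/= mulr0 !mul0r.
have h0 : 0 <= h by rewrite (le_trans _ (sh 0))// sqr_ge0.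
set D := (_ *m _) 0 0.
have D0 : 0 <= D.
  rewrite -(pmulr_rge0 _ (ltr0n R 2)) laplacian_dirichlet//.
  by do ?[apply: sumr_ge0 => ? _]; rewrite mulr_ge0 ?sqr_ge0.
have Dle : D <= N.+1%:R ^+ 2 * Num.sqrt (h * (2 * D / c)).
  (* Subtracting the constant [p 0 0] is free because [p *m laplacian w] sums to 0. *)
  have DE : D = \sum_i (p *m laplacian w) 0 i * (p 0 i - p 0 0).
    transitivity (\sum_i ((p *m laplacian w) 0 i * p 0 i
                          - (p *m laplacian w) 0 i * p 0 0)).
      rewrite sumrB -mulr_suml s0 mul0r subr0 /D mxE.
      by apply: eq_bigr => i _; rewrite [p^T _ _]mxE.
    by apply: eq_bigr => i _; rewrite mulrBr.
  rewrite {1}DE.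
  apply: (@le_trans _ _ (\sum_(i < N.+1) N.+1%:R * Num.sqrt (h * (2 * D / c)))).
    apply: ler_sum => i _; rewrite (le_trans (ler_norm _))// normrM.
    rewrite sqrtrM// mulrCA ler_pM//; last exact: (laplacian_dist_le _ _ _ ce).
    by rewrite -sqrtr_sqr ler_sqrt.
  by rewrite sumr_const card_ord expr2 -(mulrA N.+1%:R) [leRHS]mulr_natl.
have [->|Dn0] := eqVneq D 0.
  by rewrite !mulr_ge0 ?invr_ge0 ?exprn_ge0 ?(ltW c0).
have Dgt0 : 0 < D by rewrite lt_def Dn0.
(* [D] also occurs under the root in [Dle]: squaring that bound and cancelling one factor [D] leaves
   a bound linear in [h]. *)
rewrite -(ler_pM2l Dgt0) -expr2.
apply: le_trans (_ : (N.+1%:R ^+ 2 * Num.sqrt (h * (2 * D / c))) ^+ 2 <= _).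
  by rewrite ler_pXn2r// nnegrE mulr_ge0 ?sqrtr_ge0 ?exprn_ge0.
rewrite exprMn sqr_sqrtr ?mulr_ge0 ?invr_ge0 ?(ltW c0)//.
by rewrite le_eqVlt; apply/orP; left; apply/eqP; ring.
Qed.

(* The integral of a nonnegative function is a supremum over the simple
   functions below it, so monotonicity needs no measurability; this avoids
   proving that [pinvmx] is measurable along a curve. *)
Lemma ge0_le_integral_nonmeasurable d (T : measurableType d) (R : realType)
    (mu : {measure set T -> \bar R}) (D : set T) (f g : T -> \bar R) :
  (forall x, D x -> 0 <= f x)%E -> (forall x, D x -> f x <= g x)%E ->
  (\int[mu]_(x in D) f x <= \int[mu]_(x in D) g x)%E.
Proof.
move=> f0 fg; rewrite !(integral_mkcond D).
have g0 x : D x -> (0 <= g x)%E by move=> Dx; rewrite (le_trans (f0 x Dx))// fg.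
rewrite !ge0_integralTE; [|exact: erestrict_ge0..].
apply: ereal_sup_le => _ [h /= hf <-]; exists h => //= x.
exact: le_trans (hf x) (lee_restrict fg x).
Qed.

Lemma compact_simplex_lbound (R : realType) (N : nat) (B : set 'rV[R]_N) :
  compact B -> B !=set0 -> B `<=` @simplex_interior R N ->
  exists2 c : R, 0 < c & forall nu i, B nu -> c <= nu 0 i.
Proof.
move=> cB B0 BM.
have /choice[c hc] (i : 'I_N) :
    exists c : R, 0 < c /\ forall nu, B nu -> c <= nu 0 i.
  have [|m] := @compact_EVT_min _ _ (fun nu : 'rV[R]_N => nu 0 i) B B0 cB.
    exact/continuous_subspaceT/coord_continuous.
  rewrite inE => Bm hm; exists (m 0 i); split; first exact: (BM _ Bm).2.
  by move=> nu Bnu; apply: hm; rewrite inE.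
(* The default 1 keeps the minimum positive even when there is no coordinate. *)
exists (\big[Num.min/1]_i c i).
  by apply: lt_bigmin => // i _; exact: (hc i).1.
by move=> nu i Bnu; rewrite (le_trans (bigmin_le _ i _))// (hc i).2.
Qed.

Definition segment (R : realType) (N : nat) (a b : 'rV[R]_N) (t : R) : 'rV[R]_N :=
  a + t *: (b - a).

Lemma segmentE (R : realType) (N : nat) (a b : 'rV[R]_N) (t : R) (i : 'I_N) :
  segment a b t 0 i = (1 - t) * a 0 i + t * b 0 i.
Proof. by rewrite !mxE; ring. Qed.

Lemma segment_ge (R : realType) (N : nat) (a b : 'rV[R]_N) (c t : R) (i : 'I_N) :
  c <= a 0 i -> c <= b 0 i -> t \in `[0, 1] -> c <= segment a b t 0 i.
Proof. by rewrite in_itv/= segmentE => ca cb /andP[t0 t1]; nra. Qed.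

Lemma segment_admissible (R : realType) (N : nat) (a b : 'rV[R]_N) :
  simplex_interior a -> simplex_interior b ->
  admissible a b (segment a b) (cst (b - a)).
Proof.
move=> [a1 a0] [b1 b0]; split.
- split; last exact/continuous_subspaceT/cst_continuous.
  move=> t _; apply: cvg_near_cst; apply: cvg_within.
  (* For [s] different from [t] the difference quotient is exactly [b - a]. *)
  near=> s.
  have st : s - t != 0 by rewrite subr_eq0; near: s; exact: nbhs_dnbhs_neq.
  rewrite /segment opprD addrACA subrr add0r -scalerBl scalerA mulVf//.
  by rewrite scale1r.
- move=> t t01; split.
    under eq_bigr do rewrite segmentE.
    by rewrite big_split/= -!mulr_sumr a1 b1; ring.
  move=> i; apply: (@lt_le_trans _ _ (Num.min (a 0 i) (b 0 i))).
    by rewrite lt_min a0 b0.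
  by apply: segment_ge => //; rewrite ge_min lexx ?orbT.
- by rewrite /segment scale0r addr0.
- by rewrite /segment scale1r addrC subrK.
Unshelve. all: by end_near.
Qed.

Lemma wdist_ge0 (R : realType) (N : nat) (e : rel 'I_N) (Psi a b : 'rV[R]_N) :
  (0 <= wdist e Psi a b)%E.
Proof.
apply: le_ereal_inf_tmp => _ [g [dg [_ ->]]].
by apply: integral_ge0 => t _; rewrite lee_fin sqrtr_ge0.
Qed.

(** The segment competes in the infimum, and the unit interval has measure 1. *)
Lemma wdist_segment_le (R : realType) (N : nat) (e : rel 'I_N)
    (Psi a b : 'rV[R]_N) (M : R) :
  simplex_interior a -> simplex_interior b ->
  (forall t, t \in `[0, 1] ->
    wmetric e Psi (segment a b t) (b - a) (b - a) <= M) ->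
  (wdist e Psi a b <= (Num.sqrt M)%:E)%E.
Proof.
move=> aM bM hM; apply: (@le_trans _ _
  (curve_length e Psi (segment a b) (cst (b - a)))).
  by apply: ereal_inf_lbound; exists (segment a b), (cst (b - a)); split => //;
    exact: segment_admissible.
apply: (@le_trans _ _
    (\int[lebesgue_measure]_(t in `[0%R, 1%R]) (Num.sqrt M)%:E)%E).
  apply: ge0_le_integral_nonmeasurable => t /= t01; rewrite lee_fin ?sqrtr_ge0//.
  exact/ler_wsqrtr/hM.
rewrite integral_cst//= lebesgue_measure_itv/= lte01 sube0.
by rewrite mule1.
Qed.

Theorem theorem4p2 (R : realType) (N : nat) (e : rel 'I_N)
    (hN : (2 <= N)%N) (he : connected_simple_graph e)
    (mu : 'rV[R]_N) (hmu : simplex_interior mu)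
    (B : set 'rV[R]_N) (hBM : B `<=` @simplex_interior R N) (hB : compact B) :
  exists (Psi : 'rV[R]_N) (K : R), 0 < K /\
    forall nu : 'rV[R]_N, B nu ->
      ((wdist e Psi mu nu) ^+ 2 <= (K * rel_entropy nu mu)%:E)%E.
Proof.
have [irr es ce] := he.
(* Adding [mu] to [B] covers the starting point of every segment and makes the set nonempty. *)
have [c c0 hc] : exists2 c : R, 0 < c & forall nu i, (mu |` B) nu -> c <= nu 0 i.
  apply: compact_simplex_lbound; last by move=> nu [->|/hBM].
    by apply: compactU => //; exact: compact_set1.
  by exists mu; left.
(* Distinct values at distinct vertices: the logarithmic mean never occurs on an edge. *)
pose Psi : 'rV[R]_N := \row_i i%:R.
exists Psi, (8 * N%:R ^+ 4 / c); split.
  by rewrite divr_gt0// mulr_gt0// exprn_gt0// ltr0n ltnW.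
move=> nu Bnu; have hnu := hBM _ Bnu.
have H0 : 0 <= rel_entropy nu mu.
  rewrite -(pmulr_rge0 _ (ltr0n R 4)).
  exact: le_trans (sqr_ge0 _) (rel_entropy_ge (Ordinal (ltnW hN)) hnu hmu).
set K := 8 * _ / c.
have K0 : 0 <= K by rewrite !mulr_ge0 ?invr_ge0 ?exprn_ge0 ?(ltW c0).
(* Writing the right side as a square reduces the claim to a bound on [wdist] itself, both sides
   being nonnegative. *)
rewrite -(sqr_sqrtr (mulr_ge0 K0 H0)) EFin_expe lee_sqr ?wdist_ge0 ?lee_fin ?sqrtr_ge0//.
apply: wdist_segment_le => // t t01.
set w := weight e Psi (segment mu nu t).
have rc i : c <= segment mu nu t 0 i.
  by apply: segment_ge => //; apply: hc; [left|right].
have cw i j : e i j -> c <= w i j.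
  rewrite mxE => eij; rewrite eij /= ![Psi 0 _]mxE !ltr_nat.
  case: ltngtP => [_|_|/val_inj ij]; do ?exact: rc.
  by rewrite ij irr in eij.
have w0 i j : 0 <= w i j.
  have [/cw/(le_trans (ltW c0))//|eij] := boolP (e i j).
  by rewrite mxE eij.
have wT : w^T = w by exact: weight_sym.
have s0 : \sum_i (nu - mu) 0 i = 0.
  under eq_bigr do rewrite !mxE.
  by rewrite sumrB hnu.1 hmu.1 subrr.
(* The velocity lies in the row space, so [pinvmx] yields a genuine potential for it. *)
have sL := mulmxKpV (sub_laplacian ce wT w0 c0 cw s0).
rewrite /wmetric -/w.
apply: le_trans (laplacian_energy_le (h := 4 * rel_entropy nu mu) ce wT w0 c0 cw _ _) _.
- by rewrite sL.
- by move=> i; rewrite sL !mxE; exact: rel_entropy_ge.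
- by rewrite le_eqVlt; apply/orP; left; apply/eqP; rewrite /K; ring.
Qed.
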